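(* Let $(L,\cdot)$ be a loop and let $A(L)$ be a group of automorphisms of $(L,\cdot)$. Then the $A(L)$-holomorph $(H,\circ)$ of $(L,\cdot)$ is an Osborn loop if and only if $$x\alpha\cdot\big((y\cdot z)\cdot x\phi^{-1}\big)=\Big(x\alpha\cdot\big((y\cdot x^{\lambda})\cdot x\big)\Big)\cdot\big(z\cdot x\phi^{-1}\big)$$ for all $x,y,z\in L$ and all $\alpha,\phi\in A(L)$.
   Context: Maps are written on the right ($x\alpha$ is the image of $x$ under $\alpha$) and composed from left to right. A loop $(L,\cdot)$ is a set with a binary operation having a two-sided identity $e$ such that $a\cdot x=b$ and $y\cdot a=b$ have unique solutions $x,y$ for all $a,b$. For $x\in L$, $x^{\lambda}$ and $x^{\rho}$ are defined by $x^{\lambda}\cdot x=e$ and $x\cdot x^{\rho}=e$; $x\backslash y$ is the unique $z$ with $x\cdot z=y$. A loop is an Osborn loop if it satisfies any one of the identities $x((yz)x)=(x^{\lambda}\backslash y)(zx)$; $x((yz)x)=\big(x((yx^{\lambda})x)\big)(zx)$; $x((yz)x)=\big(x((yx)x^{\rho})\big)(zx)$. For a group $A(L)$ of automorphisms of $(L,\cdot)$ (a subgroup of the full automorphism group of $L$), the $A(L)$-holomorph (also called A-holomorph) of $(L,\cdot)$ is the loop $(H,\circ)$ with $H=A(L)\times L$ and $(\alpha,x)\circ(\beta,y)=(\alpha\beta,\,x\beta\cdot y)$. *)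

(* Defs.v *)
From Stdlib Require Import ClassicalEpsilon FunctionalExtensionality.

Set Implicit Arguments.
Unset Strict Implicit.
Unset Printing Implicit Defensive.

Declare Scope loop_scope.
Delimit Scope loop_scope with L.
Local Open Scope loop_scope.

Record loop : Type := Loop {
  loop_car :> Type;
  lmul : loop_car -> loop_car -> loop_car;
  lone : loop_car;
  lmul1l : forall x, lmul lone x = x;
  lmul1r : forall x, lmul x lone = x;
  ldiv_unique : forall a b, exists! x, lmul a x = b;
  rdiv_unique : forall a b, exists! y, lmul y a = b
}.

Arguments lone {l}.

Notation "x * y" := (lmul x y) : loop_scope.

Definition ldiv (L : loop) (x y : L) : L :=
  proj1_sig (constructive_definite_description _ (ldiv_unique x y)).

Definition linv (L : loop) (x : L) : L :=
  proj1_sig (constructive_definite_description _ (rdiv_unique x lone)).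

Definition rinv (L : loop) (x : L) : L := ldiv x lone.

Notation "x ^l" := (linv x) (at level 2, left associativity, format "x ^l") : loop_scope.
Notation "x ^r" := (rinv x) (at level 2, left associativity, format "x ^r") : loop_scope.

(* Any one of the three identities suffices; they are in fact equivalent in
   every loop. *)
Definition osborn (L : loop) : Prop :=
  (forall x y z : L, x * ((y * z) * x) = ldiv x^l y * (z * x)) \/
  (forall x y z : L, x * ((y * z) * x) = (x * ((y * x^l) * x)) * (z * x)) \/
  (forall x y z : L, x * ((y * z) * x) = (x * ((y * x) * x^r)) * (z * x)).

(* Maps are written on the right in the source: [alpha x] is x alpha. *)
Record aut (L : loop) : Type := Aut {
  aut_fun :> L -> L;
  aut_invfun : L -> L;
  aut_funK : forall x, aut_invfun (aut_fun x) = x;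
  aut_invfunK : forall x, aut_fun (aut_invfun x) = x;
  autM : forall x y, aut_fun (x * y) = aut_fun x * aut_fun y
}.

Lemma autP (L : loop) (f g : aut L) : (forall x, f x = g x) -> f = g.
Proof.
intros fg.
assert (E1 : aut_fun f = aut_fun g) by (apply functional_extensionality; exact fg).
assert (E2 : aut_invfun f = aut_invfun g).
{ apply functional_extensionality; intro x.
  rewrite <- (aut_invfunK g x) at 1. rewrite <- fg. apply aut_funK. }
destruct f as [f f' ? ? ?], g as [g g' ? ? ?]; simpl in *; subst g g'.
f_equal; apply proof_irrelevance.
Qed.

Definition aut_id (L : loop) : aut L :=
  @Aut L (fun x => x) (fun x => x)
    (fun x => eq_refl) (fun x => eq_refl) (fun x y => eq_refl).

(* Left-to-right composition: x (f g) = (x f) g. *)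
Definition aut_comp (L : loop) (f g : aut L) : aut L.
Proof.
refine (@Aut L (fun x => g (f x)) (fun x => aut_invfun f (aut_invfun g x)) _ _ _).
- intro x; rewrite !aut_funK; reflexivity.
- intro x; rewrite !aut_invfunK; reflexivity.
- intros x y; rewrite !autM; reflexivity.
Defined.

Definition aut_inv (L : loop) (f : aut L) : aut L.
Proof.
refine (@Aut L (aut_invfun f) f (aut_invfunK f) (aut_funK f) _).
intros x y.
rewrite <- (aut_invfunK f x) at 1; rewrite <- (aut_invfunK f y) at 1.
rewrite <- autM; apply aut_funK.
Defined.

Record autgroup (L : loop) : Type := AutGroup {
  autgroup_mem :> aut L -> Prop;
  autgroup_id : autgroup_mem (aut_id L);
  autgroup_comp : forall f g,
    autgroup_mem f -> autgroup_mem g -> autgroup_mem (aut_comp f g);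
  autgroup_inv : forall f, autgroup_mem f -> autgroup_mem (aut_inv f)
}.

Definition holo_car (L : loop) (A : autgroup L) : Type := ({f : aut L | A f} * L)%type.

Definition holo_mul (L : loop) (A : autgroup L) (u v : holo_car A) : holo_car A :=
  let (a, x) := u in
  let (b, y) := v in
  (exist _ (aut_comp (proj1_sig a) (proj1_sig b))
           (autgroup_comp (proj2_sig a) (proj2_sig b)),
   proj1_sig b x * y).

Definition holo_one (L : loop) (A : autgroup L) : holo_car A := (exist _ (aut_id L) (autgroup_id A), lone).

Lemma holo_eq (L : loop) (A : autgroup L) (u v : holo_car A) :
  (forall x, proj1_sig (fst u) x = proj1_sig (fst v) x) -> snd u = snd v -> u = v.
Proof.
destruct u as [[f Af] x], v as [[g Ag] y]; simpl; intros fg ->.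
apply autP in fg; subst g.
now rewrite (proof_irrelevance _ Af Ag).
Qed.

Lemma aut1 (L : loop) (f : aut L) : f lone = lone.
Proof.
destruct (ldiv_unique (f lone) (f lone)) as [w [_ Hw]].
transitivity w.
- symmetry; apply Hw. rewrite <- autM, lmul1l; reflexivity.
- apply Hw, lmul1r.
Qed.

Lemma holo_mul1l (L : loop) (A : autgroup L) (u : holo_car A) : holo_mul (holo_one A) u = u.
Proof.
destruct u as [[f Af] x]; apply holo_eq; simpl; [reflexivity|].
now rewrite aut1, lmul1l.
Qed.

Lemma holo_mul1r (L : loop) (A : autgroup L) (u : holo_car A) : holo_mul u (holo_one A) = u.
Proof.
destruct u as [[f Af] x]; apply holo_eq; simpl; [reflexivity|].
apply lmul1r.
Qed.

Lemma holo_ldiv (L : loop) (A : autgroup L) (u v : holo_car A) : exists! w, holo_mul u w = v.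
Proof.
destruct u as [[f Af] x], v as [[g Ag] y].
pose (h := aut_comp (aut_inv f) g).
assert (Ah : A h) by (apply autgroup_comp; [apply autgroup_inv|]; assumption).
destruct (ldiv_unique (h x) y) as [z [Hz Uz]].
exists (exist _ h Ah, z); split.
- apply holo_eq; simpl; [|exact Hz].
  intro t; now rewrite aut_funK.
- intros [[k Ak] t] E.
  assert (Ek : aut_comp f k = g) by exact (f_equal (fun w => proj1_sig (fst w)) E).
  assert (Et : k x * t = y) by exact (f_equal snd E).
  assert (kE : forall s, h s = k s).
  { intro s; unfold h; simpl; rewrite <- Ek; simpl; now rewrite aut_invfunK. }
  apply holo_eq; simpl; [exact kE|].
  apply Uz; now rewrite kE.
Qed.

Lemma holo_rdiv (L : loop) (A : autgroup L) (u v : holo_car A) : exists! w, holo_mul w u = v.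
Proof.
destruct u as [[f Af] x], v as [[g Ag] y].
pose (h := aut_comp g (aut_inv f)).
assert (Ah : A h) by (apply autgroup_comp; [|apply autgroup_inv]; assumption).
destruct (rdiv_unique x y) as [z [Hz Uz]].
exists (exist _ h Ah, aut_inv f z); split.
- apply holo_eq; simpl; [|now rewrite aut_invfunK].
  intro t; now rewrite aut_invfunK.
- intros [[k Ak] t] E.
  assert (Ek : aut_comp k f = g) by exact (f_equal (fun w => proj1_sig (fst w)) E).
  assert (Et : f t * x = y) by exact (f_equal snd E).
  apply holo_eq; simpl.
  + intro s; rewrite <- Ek; simpl; now rewrite aut_funK.
  + rewrite (Uz _ Et); apply aut_funK.
Qed.

Definition holomorph (L : loop) (A : autgroup L) : loop :=
  @Loop (holo_car A) (@holo_mul L A) (holo_one A) (@holo_mul1l L A) (@holo_mul1r L A)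
    (@holo_ldiv L A) (@holo_rdiv L A).

(* Main.v *)
Require Import Defs.

Local Open Scope loop_scope.

(** Each Osborn identity has the shape [x ((y z) x) = G x y * (z x)]; at
    [z = x^l] it gives [G x y = x ((y x^l) x)], hence the second identity.
    Compare that one in the holomorph, at [(a, x)], [(b, y)], [(c, z)], with
    the displayed equation: they agree for [phi = c a] and
    [alpha = phi^-1 b phi], and these range over all pairs of the group. *)

Lemma lmulIr (L : loop) (a x y : L) : x * a = y * a -> x = y.
Proof.
intro E; destruct (rdiv_unique a (y * a)) as [w [_ U]].
now rewrite <- (U x E); apply U.
Qed.

Lemma linvK (L : loop) (x : L) : x^l * x = lone.
Proof. apply (proj2_sig (P := fun y => y * x = lone)). Qed.

Lemma linv_unique (L : loop) (x y : L) : y * x = lone -> y = x^l.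
Proof. intro E; apply (lmulIr L x); now rewrite linvK. Qed.

(** An automorphism fixes [lone], so [f x^l] is a left inverse of [f x]. *)
Lemma aut_linv (L : loop) (f : aut L) (x : L) : f x^l = (f x)^l.
Proof. apply linv_unique; now rewrite <- autM, linvK, aut1. Qed.

Lemma osbornP (L : loop) :
  osborn L <->
  forall x y z : L, x * ((y * z) * x) = (x * ((y * x^l) * x)) * (z * x).
Proof.
split; [intros [H | [H | H]] | now right; left]; intros x y z.
- now rewrite H, (H x y x^l), linvK, lmul1r.
- apply H.
- now rewrite H, (H x y x^l), linvK, lmul1r.
Qed.

(** Solving [(g, w) (f, x) = 1] forces [g = f^-1] and [f w = x^l]. *)
Lemma holo_linv (L : loop) (A : autgroup L) (u : holomorph A) :
  u^l = (exist _ (aut_inv (proj1_sig (fst u)))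
           (autgroup_inv (proj2_sig (fst u))),
         aut_inv (proj1_sig (fst u)) (snd u)^l) :> holo_car A.
Proof.
symmetry; apply (linv_unique (holomorph A)).
destruct u as [[f Af] x]; apply holo_eq; simpl.
- intro t; apply aut_invfunK.
- now rewrite aut_invfunK, linvK.
Qed.

Theorem theorem3p1 (L : loop) (A : autgroup L) :
  osborn (holomorph A) <->
  forall (x y z : L) (alpha phi : aut L), A alpha -> A phi ->
    alpha x * ((y * z) * aut_inv phi x)
    = (alpha x * ((y * x^l) * x)) * (z * aut_inv phi x).
Proof.
rewrite osbornP; split.
- intros H x y z alpha phi Aa Ap.
  assert (Ab : A (aut_comp phi (aut_comp alpha (aut_inv phi)))).
  { apply autgroup_comp; [|apply autgroup_comp; [|apply autgroup_inv]];
      assumption. }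
  (* The choice [a = 1], [c = phi]; [phi] acts on the entries of [X] and [Y] in the products, hence
     the [aut_inv phi]. *)
  pose (X := (exist _ (aut_id L) (autgroup_id A), aut_inv phi x)
               : holomorph A).
  pose (Y := (exist _ _ Ab, aut_inv phi y) : holomorph A).
  pose (Z := (exist _ _ Ap, z) : holomorph A).
  generalize (f_equal snd (H X Y Z)); rewrite holo_linv; simpl.
  now rewrite !autM, aut_linv, !aut_invfunK.
- intros H [[a Aa] x] [[b Ab] y] [[c Ac] z]; rewrite holo_linv.
  pose (phi := aut_comp c a).
  assert (Ap : A phi) by now apply autgroup_comp.
  assert (Al : A (aut_comp (aut_inv phi) (aut_comp b phi))).
  { apply autgroup_comp; [apply autgroup_inv|apply autgroup_comp];
      assumption. }
  apply holo_eq; simpl.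
  (* Both sides have first component [a b c a], once [a^-1 a] cancels. *)
  + intro t; now rewrite aut_invfunK.
  (* These arguments are the images that the product leaves: [c] then [a] act on [y], only [a] on
     [z]. *)
  + generalize (H (phi x) (phi y) (a z) _ _ Al Ap); simpl.
    rewrite !autM, !aut_funK, !aut_invfunK, !aut_linv; auto.
Qed.
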